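(* Let $f$ be a convex, $L(\cdot)$-inexactly smooth function. Then: 1. for any $\alpha>0$, $\alpha f(x)$ is $\alpha L(\cdot/\alpha)$-inexactly smooth; 2. for any matrix $A$ and vector $b$ of compatible dimensions, $x\mapsto f(Ax-b)$ is $\|A\|_{\mathrm{op}}^2L(\cdot)$-inexactly smooth; 3. if $f=f(x,z)$ is a function of two blocks of variables and $F(x)=\inf_zf(x,z)$ is closed and proper, with the infimum attained for each $x$, then $F$ is $L(\cdot)$-inexactly smooth.
   Context: All functions are closed, convex, proper functions from a Euclidean space to $(-\infty,\infty]$; norms are Euclidean and $\|A\|_{\mathrm{op}}$ is the operator norm. $L:[0,\infty)\to(0,\infty]$ is finite for all $\delta>0$, convex, lower semicontinuous, nonincreasing, and $-1/L(\cdot)$ is convex (with $1/\infty=0$). A convex $f$ is $L(\cdot)$-inexactly smooth if for all $x,y$, all $g_x\in\partial f(x)$ (convex subdifferential) and all $\delta\ge0$: $f(y)\le f(x)+\langle g_x,y-x\rangle+\frac{L(\delta)}2\|y-x\|^2+\delta$ (nothing is imposed when $L(\delta)=\infty$). The same defining inequality is used when the modulus takes the value $0$ (as in item 2 with $A=0$). *)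

(* Defs.v *)
From mathcomp Require Import all_boot all_order all_algebra.
From mathcomp Require Import all_classical all_reals all_analysis.

Set Implicit Arguments.
Unset Strict Implicit.
Unset Printing Implicit Defensive.

Import Order.TTheory GRing.Theory Num.Theory.
Import numFieldNormedType.Exports.

Local Open Scope classical_set_scope.
Local Open Scope ring_scope.

(* The Euclidean space of dimension n is 'cV[R]_n.  The norm `|_| that
   MathComp-Analysis puts on matrices is the sup norm, hence [enorm]; the
   topology is the same. *)
Definition dotv (R : realType) (n : nat) (u v : 'cV[R]_n) : R :=
  \sum_(i < n) u i 0 * v i 0.

Definition enorm (R : realType) (n : nat) (u : 'cV[R]_n) : R :=
  Num.sqrt (dotv u u).

Definition opnorm (R : realType) (m n : nat) (A : 'M[R]_(m, n)) : R :=
  sup [set enorm (A *m x) | x in [set x : 'cV[R]_n | enorm x <= 1]].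

(* Only meant for functions that never take the value -oo on D; the convention
   0 * +oo = 0 of \bar R makes the cases t = 0 and t = 1 trivial. *)
Definition econvex_on (R : realType) (E : lmodType R) (D : set E)
    (f : E -> \bar R) : Prop :=
  forall (x y : E) (t : R), D x -> D y -> 0 <= t <= 1 ->
    (f (t *: x + (1 - t) *: y)%R <= t%:E * f x + (1 - t)%:E * f y)%E.

Definition econvex (R : realType) (E : lmodType R) (f : E -> \bar R) : Prop :=
  econvex_on setT f.

Definition proper_fun (R : realType) (T : Type) (f : T -> \bar R) : Prop :=
  (forall x, (-oo < f x)%E) /\ (exists x, (f x < +oo)%E).

(* For a function that never takes the value -oo, closedness is lower
   semicontinuity. *)
Definition closed_fun (R : realType) (n : nat) (f : 'cV[R]_n -> \bar R) :
    Prop :=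
  lower_semicontinuous f.

Definition closed_convex_proper (R : realType) (n : nat)
    (f : 'cV[R]_n -> \bar R) : Prop :=
  [/\ closed_fun f, econvex f & proper_fun f].

(* When f is proper this set is empty at every x with f x = +oo. *)
Definition subdifferential (R : realType) (n : nat) (f : 'cV[R]_n -> \bar R)
    (x : 'cV[R]_n) : set 'cV[R]_n :=
  [set g | forall y, (f x + (dotv g (y - x))%:E <= f y)%E].

(* A modulus is a function on [0, +oo[; it is represented by a function on R
   whose values at negative arguments are irrelevant.  The topology of
   [subspace D] is trivial outside D, so lower semicontinuity is that of the
   restriction of L to [0, +oo[.  In \bar R, (+oo)^-1 = 0. *)
Definition smoothness_modulus (R : realType) (L : R -> \bar R) : Prop :=
  [/\ (forall d : R, 0 <= d -> (0 < L d)%E),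
      (forall d : R, 0 < d -> (L d < +oo)%E),
      @econvex_on R R^o `[0, +oo[ L,
      @lower_semicontinuous (subspace (`[0, +oo[ : set R)) R L &
      (forall d e : R, 0 <= d -> d <= e -> (L e <= L d)%E) /\
      @econvex_on R R^o `[0, +oo[ (fun d => - (L d)^-1)%E].

(* L is an arbitrary function here, so that moduli with value 0 make sense. *)
Definition inexactly_smooth (R : realType) (n : nat) (L : R -> \bar R)
    (f : 'cV[R]_n -> \bar R) : Prop :=
  closed_convex_proper f /\
  forall (x y g : 'cV[R]_n) (d : R),
    subdifferential f x g -> 0 <= d -> (L d < +oo)%E ->
    (f y <= f x + (dotv g (y - x))%:E
            + L d * (2^-1 * enorm (y - x) ^+ 2)%:E + d%:E)%E.

(* A function of two blocks (x, z) is a function of the stacked vector. *)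
Definition partial_inf (R : realType) (n p : nat)
    (f : 'cV[R]_(n + p) -> \bar R) (x : 'cV[R]_n) : \bar R :=
  ereal_inf (range (fun z : 'cV[R]_p => f (col_mx x z))).

(* Main.v *)
(* Since L is finite at positive arguments, one subgradient anywhere forces f to
   be finite everywhere.  A closed convex proper f has subgradients at points v
   arbitrarily close to any x of its domain: for c large, f + c |. - x|^2 has a
   minimizer v near x, and 2 c (x - v) is a subgradient of f at v.
   If g is a subgradient of f(A . - b) at x, then along the line through
   u = A x - b in the direction w = A (y - x) the slope <g, y - x> supports f, so
   the subgradients found near u - s w have slope along w at most <g, y - x> up
   to an error vanishing with s, and their smoothness inequality yields the one
   wanted.  For the partial infimum, (g, 0) is a subgradient of f at (x, z)
   whenever z attains the infimum at x. *)
Require Import Defs.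
From mathcomp Require Import all_boot all_order all_algebra.
From mathcomp Require Import all_classical all_reals all_analysis.
From mathcomp Require Import ring lra.

Set Implicit Arguments.
Unset Strict Implicit.
Unset Printing Implicit Defensive.

Import Order.TTheory GRing.Theory Num.Theory.
Import numFieldNormedType.Exports.

Local Open Scope classical_set_scope.
Local Open Scope ring_scope.

(** * Euclidean inner product, norm and balls *)

Section Euclidean.
Variables (R : realType) (n : nat).
Implicit Types (u v w : 'cV[R]_n) (a : R).

Lemma dotvC u v : dotv u v = dotv v u.
Proof. by apply: eq_bigr => i _; rewrite mulrC. Qed.

Lemma dotvDr u v w : dotv u (v + w) = dotv u v + dotv u w.
Proof. by rewrite -big_split; apply: eq_bigr => i _; rewrite mxE mulrDr. Qed.

Lemma dotvZr a u v : dotv u (a *: v) = a * dotv u v.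
Proof. by rewrite mulr_sumr; apply: eq_bigr => i _; rewrite mxE mulrCA. Qed.

Lemma dotvNr u v : dotv u (- v) = - dotv u v.
Proof. by rewrite -scaleN1r dotvZr mulN1r. Qed.

Lemma dotvDl u v w : dotv (v + w) u = dotv v u + dotv w u.
Proof. by rewrite dotvC dotvDr !(dotvC u). Qed.

Lemma dotvZl a u v : dotv (a *: u) v = a * dotv u v.
Proof. by rewrite dotvC dotvZr dotvC. Qed.

Lemma dotvv_ge0 u : 0 <= dotv u u.
Proof. by apply: sumr_ge0 => i _; rewrite -expr2 sqr_ge0. Qed.

Lemma sqr_coord_le_dotv u i : u i 0 ^+ 2 <= dotv u u.
Proof.
rewrite /dotv (bigD1 i)//= -expr2 lerDl.
by apply: sumr_ge0 => j _; rewrite -expr2 sqr_ge0.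
Qed.

Lemma enorm_ge0 u : 0 <= enorm u.
Proof. exact: sqrtr_ge0. Qed.

Lemma enorm_sqr u : enorm u ^+ 2 = dotv u u.
Proof. by rewrite sqr_sqrtr ?dotvv_ge0. Qed.

Lemma enormZ a u : enorm (a *: u) = `|a| * enorm u.
Proof.
by rewrite /enorm dotvZl dotvZr mulrA -expr2 sqrtrM ?sqr_ge0// sqrtr_sqr.
Qed.

Lemma coord_le_enorm u i : `|u i 0| <= enorm u.
Proof. by rewrite -sqrtr_sqr ler_wsqrtr// sqr_coord_le_dotv. Qed.

Lemma enorm_eq0 u : enorm u = 0 -> u = 0.
Proof.
move=> u0; apply/colP => i; rewrite mxE; apply/eqP.
by rewrite -normr_le0 -u0 coord_le_enorm.
Qed.

Lemma sqr_dist_continuous w : continuous (fun v => dotv (v - w) (v - w)).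
Proof.
apply: continuous_big => [|i _ v]; first exact: add_continuous.
have cv : continuous_at v (fun u : 'cV[R]_n => (u - w) i 0).
  rewrite (_ : (fun u => _) = (fun u => u i 0) - (fun=> w i 0)); last first.
    by apply/funext => u; rewrite !mxE.
  by apply: continuousB; [exact: coord_continuous|exact: cst_continuous].
exact: (continuousM cv cv).
Qed.

(** The ball is a closed subset of a box with half-width [|r|], [r] having no prescribed sign.
    Compactness of boxes is available for row vectors and is carried over by transposition. *)
Lemma enorm_ball_compact w r : compact [set v | dotv (v - w) (v - w) <= r ^+ 2].
Proof.
pose B i : set R := `[w i 0 - `|r|, w i 0 + `|r|]%classic.
have cB : compact [set v : 'cV[R]_n | forall i, B i (v i 0)].
  rewrite (_ : mkset _ = trmx @` [set v : 'rV[R]_n | forall i, B i (v 0 i)]).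
    apply: continuous_compact; last first.
      by apply: rV_compact => i; exact: segment_compact.
    apply: continuous_subspaceT => v A [P vP PA].
    exists (fun i j => P j i) => [i j|u uP].
      by have := vP j i; rewrite mxE.
    by apply: PA => i j; rewrite mxE; exact: uP.
  apply/seteqP; split => [v Bv|_ [v Bv <-] i]; last by rewrite mxE.
  by exists v^T; [move=> i; rewrite mxE|rewrite trmxK].
apply: (subclosed_compact _ cB) => [|v /= vr i].
  apply: (@preimage_closed _ _ (fun v => dotv (v - w) (v - w)) [set a | a <= r ^+ 2]).
    by move=> v _; exact: sqr_dist_continuous.
  exact: closed_le.
rewrite /B /= in_itv/= -ler_distl -ler_sqr ?nnegrE//.
rewrite !real_normK ?num_real//; apply: le_trans vr.
by have := sqr_coord_le_dotv (v - w) i; rewrite !mxE.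
Qed.

(** Neighborhoods are given by sup-norm balls, and each coordinate is at most the Euclidean norm.
    Halving the radius turns the large inequality into a strict one. *)
Lemma nbhs_enorm_ball w (V : set 'cV[R]_n) : nbhs w V ->
  exists2 r, 0 < r & [set v | dotv (v - w) (v - w) <= r ^+ 2] `<=` V.
Proof.
move=> /nbhs_ballP[e /= e0 eV]; exists (e / 2); first by rewrite divr_gt0.
move=> v /= vr; apply: eV; split=> // i j; rewrite ord1 /ball /=.
have : `|(v - w) i 0| <= e / 2.
  rewrite -ler_sqr ?nnegrE ?divr_ge0 ?(ltW e0)// real_normK ?num_real//.
  exact: le_trans (sqr_coord_le_dotv _ _) vr.
rewrite !mxE distrC => /le_lt_trans; apply.
by rewrite ltr_pdivrMr// ltr_pMr// ltr1n.
Qed.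

End Euclidean.

(** * Lower semicontinuity and minima on compact sets *)

Section lower_semicontinuity.
Variables (R : realType) (T : topologicalType).
Implicit Types (f : T -> \bar R).
Local Open Scope ereal_scope.

Lemma lsc_closed_sublevel f c :
  lower_semicontinuous f -> closed [set t | f t <= c].
Proof.
move=> lf; rewrite -openC openE => x /= /negP; rewrite -ltNge => cx.
(* Lower semicontinuity speaks of real thresholds only, whereas [c] and [f x] may be infinite. *)
have [a [ca ax]] : exists a : R, c <= a%:E /\ a%:E < f x.
  case: c cx => [a||]; [by exists a|by rewrite ltNge leey|].
  case: (f x) => [r||//] _.
  - by exists (r - 1)%R; rewrite leNye lte_fin ltrBlDr ltrDl.
  - by exists 0%R; rewrite leNye ltry.
have [V xV Va] := lf _ _ ax.
apply: filterS xV => y /Va ay; apply/negP; rewrite -ltNge.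
exact: le_lt_trans ay.
Qed.

Lemma lsc_addr f (q : T -> R) : lower_semicontinuous f -> continuous q ->
  lower_semicontinuous (fun x => f x + (q x)%:E).
Proof.
move=> lf cq x a afq.
(* The threshold splits as [a = b + (a - b)], with [b] below [f x] and [a - b] below [q x]. *)
have [b [ab bf]] : exists b : R, (a - q x < b)%R /\ b%:E < f x.
  move: afq; case: (f x) => [r||]; last by rewrite addNye.
  - rewrite -EFinD lte_fin -ltrBlDr => afr.
    by exists ((a - q x + r) / 2)%R; rewrite lte_fin; split; lra.
  - by move=> _; exists (a - q x + 1)%R; rewrite ltry; split=> //; lra.
have [V xV Vb] := lf _ _ bf.
have xW : \forall y \near x, (a - b < q y)%R.
  by apply: (cvgr_gt (q x)); [exact: cq|lra].
exists (V `&` [set y | (a - b < q y)%R]); first exact: filterI.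
move=> y [/Vb bfy abq]; rewrite (@le_lt_trans _ _ (b%:E + (a - b)%:E))//.
  by rewrite -EFinD lee_fin; lra.
by rewrite lteD.
Qed.

End lower_semicontinuity.

(** The closed sets where [f] is at most [f i], for [i] in [K], have the finite intersection
    property; a point of [K] common to all of them is a minimizer. *)
Lemma lsc_compact_min (R : realType) (T : ptopologicalType) (f : T -> \bar R)
    (K : set T) : lower_semicontinuous f -> compact K -> K !=set0 ->
  exists2 c, K c & forall t, K t -> (f c <= f t)%E.
Proof.
move=> lf cK [k0 Kk0].
have := cK; rewrite compact_In0.
move=> /(_ T K (fun i => K `&` [set t | (f t <= f i)%E]))[].
- by exists (fun i => [set t | (f t <= f i)%E]) => // i _; exact: lsc_closed_sublevel.
- move=> D' D'K.
  (* The best of finitely many points lies in all their sublevel sets; [k0] serves for the empty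
     family. *)
  have [c Kc cmin] : exists2 c, K c &
      forall i, i \in finmap.enum_fset D' -> (f c <= f i)%E.
    have : forall i, i \in finmap.enum_fset D' -> K i.
      by move=> i /D'K; rewrite inE.
    elim: (finmap.enum_fset D') => [_|i s IH sK]; first by exists k0.
    have [|c Kc cmin] := IH; first by move=> j js; apply: sK; rewrite inE js orbT.
    have Ki : K i by apply: sK; rewrite inE eqxx.
    have [ci|ic] := leP (f c) (f i).
      by exists c => // j; rewrite inE => /predU1P[->//|/cmin].
    exists i => // j; rewrite inE => /predU1P[->//|/cmin].
    exact/le_trans/ltW.
  by exists c => i /= iD'; split => //; exact: cmin.
- by move=> c cmin; exists c => [|t Kt]; [case: (cmin _ Kk0)|case: (cmin _ Kt)].
Qed.

(** This replaces a limit as [t] tends to 0: for negative [a], the choice [t = - a / (b - a)] gives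
    the value [- a ^+ 2 / (b - a)], which is negative. *)
Lemma ge0_of_affine_ge0 (R : realType) (a b : R) : 0 <= b ->
  (forall t, 0 < t <= 1 -> 0 <= a + t * b) -> 0 <= a.
Proof.
move=> b0 ab; rewrite leNgt; apply/negP => a0.
have ba0 : 0 < b - a by lra.
have := ab (- a / (b - a)).
rewrite divr_gt0 ?oppr_gt0// ler_pdivrMr// mul1r lerDr b0.
move=> /(_ isT); apply/negP; rewrite -ltNge.
rewrite (_ : _ + _ = - (a ^+ 2 / (b - a))); last by field; rewrite gt_eqF.
by rewrite oppr_lt0 divr_gt0// exprn_even_gt0//= lt_eqF.
Qed.

(** * Existence of subgradients near points of the domain *)

Section subgradients.
Variables (R : realType) (n : nat).
Implicit Types (f : 'cV[R]_n -> \bar R) (u v w x y g : 'cV[R]_n).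

Lemma dist_combE (t : R) v w x :
  dotv (t *: v + (1 - t) *: w - x) (t *: v + (1 - t) *: w - x) =
  dotv (w - x) (w - x) + 2 * t * dotv (w - x) (v - w) +
  t ^+ 2 * dotv (v - w) (v - w).
Proof.
have -> : t *: v + (1 - t) *: w - x = (w - x) + t *: (v - w).
  by apply/colP => i; rewrite !mxE; ring.
move: (w - x) (v - w) => p d.
rewrite dotvDl !dotvDr !dotvZl !dotvZr (dotvC d p).
ring.
Qed.

(** Compare [v] with [t *: y + (1 - t) *: v]. By convexity, after division by [t], the subgradient
    inequality holds up to [t * c * |y - v|^2], and [t] is arbitrarily small. *)
Lemma prox_subgradient f x v (c : R) : econvex f -> (forall y, -oo < f y)%E ->
  (f v < +oo)%E -> 0 <= c ->
  (forall y, f v + (c * dotv (v - x) (v - x))%:E <=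
             f y + (c * dotv (y - x) (y - x))%:E)%E ->
  subdifferential f v ((2 * c) *: (x - v)).
Proof.
move=> cf fNy fvy c0 vmin y.
have [a fva] : exists a, f v = a%:E.
  by exists (fine (f v)); rewrite fineK// fin_real// fNy fvy.
have := fNy y; case fyE : (f y) => [b||]//= _; last by rewrite leey.
rewrite fva -EFinD lee_fin -subr_ge0.
apply: (@ge0_of_affine_ge0 _ _ (c * dotv (y - v) (y - v))).
  by rewrite mulr_ge0// dotvv_ge0.
move=> t /andP[t0 t1].
have := cf y v t I I; rewrite (ltW t0) t1 => /(_ isT) cft.
have := le_trans (vmin _) (leeD2r _ cft).
rewrite fva fyE dist_combE -!EFinM -!EFinD lee_fin => h.
rewrite -(pmulr_rge0 _ t0) (_ : x - v = -1 *: (v - x)); last first.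
  by rewrite scaleN1r opprB.
rewrite !dotvZl.
lra.
Qed.

Lemma subgradient_near f x (V : set 'cV[R]_n) : closed_convex_proper f ->
  (f x < +oo)%E -> nbhs x V ->
  exists v c, [/\ V v, 0 <= c & subdifferential f v (c *: (x - v))].
Proof.
move=> [lf cf [fNy _]] fxy /nbhs_enorm_ball[r r0 rV].
have [a fxa] : exists a, f x = a%:E.
  by exists (fine (f x)); rewrite fineK// fin_real// fNy fxy.
pose q y := dotv (y - x) (y - x).
have qx : q x = 0.
  by rewrite /q subrr -(scale0r (0 : 'cV[R]_n)) dotvZl mul0r.
pose K := [set y | q y <= r ^+ 2].
have cK : compact K by exact: enorm_ball_compact.
have Kx : K x by rewrite /K/= qx sqr_ge0.
have K0 : K !=set0 by exists x.
have [k Kk kmin] := lsc_compact_min lf cK K0.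
have [m fkm] : exists m, f k = m%:E.
  exists (fine (f k)); rewrite fineK// fin_real// fNy/=.
  exact: le_lt_trans (kmin _ Kx) fxy.
have ma : m <= a by have := kmin _ Kx; rewrite fkm fxa lee_fin.
(* With [m] the minimum of [f] on the ball [K], this [c] makes [f + c * q] at least [f x] outside
   [K], so a minimizer over [K] is a global one. *)
pose c := (a - m) / r ^+ 2.
have c0 : 0 <= c by rewrite divr_ge0 ?sqr_ge0// subr_ge0.
have lh : lower_semicontinuous (fun y => f y + (c * q y)%:E)%E.
  apply: lsc_addr => // y.
  apply: (@continuousM _ _ (fun=> c) q); first exact: cst_continuous.
  exact: sqr_dist_continuous.
have [v Kv vmin] := lsc_compact_min lh cK K0.
have vx : (f v + (c * q v)%:E <= a%:E)%E.
  by have := vmin _ Kx; rewrite qx mulr0 adde0 fxa.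
have fvy : (f v < +oo)%E.
  by move: vx; case: (f v) => [s||]; rewrite ?ltry ?ltNyr// addye// leye_eq.
exists v, (2 * c); split; [exact: rV|by rewrite mulr_ge0|].
apply: prox_subgradient => // y.
have [Ky|] := leP (q y) (r ^+ 2); first exact: (vmin y).
move=> rq; apply: (le_trans vx).
have := fNy y; case fyE : (f y) => [b||]//= _; last by rewrite addye// leey.
rewrite -EFinD lee_fin.
(* Contracting [y] towards [x] by [t^-1] lands on the sphere, where [f >= m]. Convexity then gives
   [b >= a - t * (a - m)], which [c * q y = (a - m) * t ^+ 2] compensates since [t > 1]. *)
pose t := enorm (y - x) / r.
have et : enorm (y - x) = t * r by rewrite divfK// gt_eqF.
have t1 : 1 < t.
  rewrite ltr_pdivlMr// mul1r -ltr_sqr ?nnegrE ?enorm_ge0 ?ltW//.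
  by rewrite enorm_sqr.
have t0 : 0 < t by rewrite (lt_trans _ t1).
have ti : 0 <= t^-1 <= 1 by rewrite invr_ge0 (ltW t0) invf_le1// ltW.
have qt : q y = t ^+ 2 * r ^+ 2 by rewrite /q -enorm_sqr et exprMn.
have Kz : K (t^-1 *: y + (1 - t^-1) *: x).
  rewrite /K/= /q dist_combE -/(q x) qx subrr.
  rewrite -[X in dotv X (y - x)](scale0r (0 : 'cV[R]_n)) dotvZl -/(q y) qt.
  by rewrite mul0r mulr0 !add0r mulrA -exprMn mulVf ?gt_eqF// expr1n mul1r.
have := le_trans (kmin _ Kz) (cf y x _ I I ti).
rewrite fkm fyE fxa -!EFinM -EFinD lee_fin -(ler_pM2l t0) mulrDr.
rewrite !mulrA mulrBr mulfV ?gt_eqF// mul1r mulr1 => h.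
rewrite -/(q y) qt /c (_ : _ / _ * _ = (a - m) * t ^+ 2); last first.
  by field; rewrite gt_eqF.
have : 0 <= (a - m) * (t * (t - 1)).
  by rewrite mulr_ge0 ?subr_ge0// mulr_ge0 ?subr_ge0 ?ltW//.
lra.
Qed.

End subgradients.

(** * Affine maps, stacked vectors and the operator norm *)

Section Euclidean_maps.
Variable R : realType.

Lemma sqr_distC n (v w : 'cV[R]_n) :
  dotv (v - w) (v - w) = dotv (w - v) (w - v).
Proof. by rewrite -(opprB w v) dotvNr dotvC dotvNr opprK. Qed.

Lemma mulmx_continuous m n (A : 'M[R]_(m, n)) (b : 'cV[R]_m) :
  continuous (fun x : 'cV[R]_n => A *m x - b).
Proof.
move=> x; apply: continuousB; last exact: cst_continuous.
move=> V /nbhs_ballP[e /= e0 eV].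
have : \forall y \near x, forall i, `|(A *m x) i 0 - (A *m y) i 0| < e.
  apply: (@filter_forall _ _
    (fun i y => `|(A *m x) i 0 - (A *m y) i 0| < e) (nbhs x)) => i.
  have : continuous_at x (fun y : 'cV[R]_n => (A *m y) i 0).
    under [X in continuous_at _ X]eq_fun do rewrite mxE.
    apply: continuous_big => [|j _ y]; first exact: add_continuous.
    apply: (@continuousM _ _ (fun=> A i j)); first exact: cst_continuous.
    exact: coord_continuous.
  by move=> /cvgr_dist_lt; apply.
apply: filterS => y Ay; apply: eV; split=> // i j.
by rewrite ord1; exact: Ay.
Qed.

Lemma dotv_col_mx n p (u u' : 'cV[R]_n) (v v' : 'cV[R]_p) :
  dotv (col_mx u v) (col_mx u' v') = dotv u u' + dotv v v'.
Proof.
rewrite /dotv big_split_ord; congr (_ + _); apply: eq_bigr => i _.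
  by rewrite !col_mxEu.
by rewrite !col_mxEd.
Qed.

(** The real [sup] in [opnorm] is a least upper bound only for a nonempty bounded set. The bound
    comes from absolute row sums, as coordinates in the unit ball are at most 1. *)
Lemma opnorm_has_sup m n (A : 'M[R]_(m, n)) :
  has_sup [set enorm (A *m x) | x in [set x : 'cV[R]_n | enorm x <= 1]].
Proof.
split.
  exists (enorm (A *m 0)), 0 => //=.
  by rewrite -(scale0r (0 : 'cV[R]_n)) enormZ normr0 mul0r.
exists (Num.sqrt (\sum_i (\sum_j `|A i j|) ^+ 2)) => _ [x /= x1 <-].
apply: ler_wsqrtr; apply: ler_sum => i _; rewrite -expr2 -[leLHS]real_normK ?num_real//.
rewrite ler_sqr ?nnegrE ?sumr_ge0// mxE; apply: le_trans (ler_norm_sum _ _ _) _.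
apply: ler_sum => j _; rewrite normrM ler_piMr//.
exact: le_trans (coord_le_enorm _ _) x1.
Qed.

Lemma enorm_mulmx_le m n (A : 'M[R]_(m, n)) (x : 'cV[R]_n) :
  enorm (A *m x) <= opnorm A * enorm x.
Proof.
have [/enorm_eq0 ->|x0] := eqVneq (enorm x) 0.
  by rewrite mulmx0 -(scale0r (0 : 'cV[R]_m)) -(scale0r (0 : 'cV[R]_n)) !enormZ
    normr0 !mul0r mulr0.
have {}x0 : 0 < enorm x by rewrite lt_def x0 enorm_ge0.
rewrite -ler_pdivrMr// mulrC -[X in X * _]ger0_norm ?invr_ge0 ?enorm_ge0//.
rewrite -enormZ scalemxAr; apply: ub_le_sup; first by case: (opnorm_has_sup A).
exists ((enorm x)^-1 *: x) => //=.
by rewrite enormZ ger0_norm ?invr_ge0 ?enorm_ge0// mulVf// gt_eqF.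
Qed.

Lemma opnorm_ge0 m n (A : 'M[R]_(m, n)) : 0 <= opnorm A.
Proof.
apply: le_trans (enorm_ge0 (A *m 0)) _; apply: ub_le_sup.
  by case: (opnorm_has_sup A).
by exists 0 => //=; rewrite -(scale0r (0 : 'cV[R]_n)) enormZ normr0 mul0r.
Qed.

End Euclidean_maps.

(** * Inexact smoothness and the three operations *)

Section inexact_smoothness.
Variables (R : realType) (L : R -> \bar R).
Hypothesis hL : smoothness_modulus L.

Lemma smoothness_modulus_fin d : 0 <= d -> (L d < +oo)%E ->
  exists2 l, 0 <= l & L d = l%:E.
Proof.
case: hL => L0 _ _ _ _ d0 Ld; exists (fine (L d)).
  by rewrite fine_ge0// ltW// L0.
by rewrite fineK// ge0_fin_numE// ltW// L0.
Qed.

Lemma inexactly_smooth_fin n (f : 'cV[R]_n -> \bar R) :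
  inexactly_smooth L f -> forall x, f x \is a fin_num.
Proof.
move=> [fccp smooth] y; have [_ _ [fNy [x fxy]]] := fccp.
rewrite fin_real// fNy/=.
have [v [c [_ _ sub]]] := subgradient_near fccp fxy (filterT : nbhs x setT).
have [l l0 L1] : exists2 l, 0 <= l & L 1 = l%:E.
  by apply: smoothness_modulus_fin => //; case: hL => _ + _ _ _; apply.
have fvy : (f v < +oo)%E.
  have := le_lt_trans (sub x) fxy.
  by case: (f v) => [s||]; rewrite ?ltry ?ltNyr.
have := smooth v y _ 1 sub ler01; rewrite L1 ltry => /(_ isT) /le_lt_trans; apply.
move: fvy (fNy v); case: (f v) => [s||]// _ _.
by rewrite -EFinM -!EFinD ltry.
Qed.

(* Subgradients at [u] itself need not have slope at most [gam] along [w], but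
   those at points near [u - s *: w] do, up to an error vanishing with [s]:
   this replaces the chain rule for subdifferentials. *)
Lemma inexactly_smooth_along n (f : 'cV[R]_n -> \bar R)
    (u w : 'cV[R]_n) (gam d : R) :
  inexactly_smooth L f ->
  (forall s : R, 0 < s ->
    (f u - (s * gam)%:E <= f (u - s *: w)%R)%E) ->
  0 <= d -> (L d < +oo)%E ->
  (f (u + w)%R <= f u + gam%:E + L d * (2^-1 * enorm w ^+ 2)%:E + d%:E)%E.
Proof.
move=> hf hgam d0 Ld; have [fccp smooth] := hf.
pose phi x := fine (f x).
have fE x : f x = (phi x)%:E by rewrite fineK// inexactly_smooth_fin.
have [l l0 Ldl] := smoothness_modulus_fin d0 Ld.
rewrite !fE Ldl -EFinM -!EFinD lee_fin; apply/ler_addgt0Pr => e e0.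
(* The slope contributes an error [eta] and the quadratic term at most [l * eta]. *)
pose eta := e / (1 + l).
have l1 : 0 < 1 + l by rewrite ltr_pwDl.
have eta0 : 0 < eta by rewrite divr_gt0.
have eE : e = eta + eta * l by rewrite -[X in X + _]mulr1 -mulrDr divfK// gt_eqF.
pose q v := dotv (v - (u + w)) (v - (u + w)).
pose W := [set v | q v < dotv w w + eta].
have nW v : W v -> nbhs v W.
  by move=> Wv; have /cvgr_lt/(_ _ Wv) := @sqr_dist_continuous _ _ (u + w) v.
have Wu : W u.
  by rewrite /W/= /q sqr_distC addrC addKr ltrDl.
have [r r0 rW] := nbhs_enorm_ball (nW _ Wu).
(* This gives [s * enorm w <= r], so [u - s *: w] lies in [W]; the added 1 covers [w = 0]. *)
pose s := r / (1 + enorm w).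
have w1 : 0 < 1 + enorm w by rewrite ltr_pwDl// enorm_ge0.
have s0 : 0 < s by rewrite divr_gt0.
have Ws : W (u - s *: w).
  apply: rW => /=.
  rewrite sqr_distC subKr -enorm_sqr enormZ (ger0_norm (ltW s0)).
  have sw0 : 0 <= s * enorm w by rewrite mulr_ge0 ?enorm_ge0// ltW.
  rewrite ler_sqr ?nnegrE ?sw0 ?(ltW r0)//.
  by rewrite /s mulrAC ler_pdivrMr// ler_pM2l// lerDr.
have [lf _ _] := fccp.
(* The allowed drop is [s * eta], since the slope estimate will be divided by [s]. *)
have [V sV Vphi] : exists2 V, nbhs (u - s *: w) V &
    forall v, V v -> phi (u - s *: w) - s * eta < phi v.
  have [|V sV Vf] := lf (u - s *: w) (phi (u - s *: w) - s * eta).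
    by rewrite fE lte_fin ltrBlDr ltrDl mulr_gt0.
  by exists V => // v /Vf; rewrite fE lte_fin.
have fs_y : (f (u - s *: w)%R < +oo)%E by rewrite fE ltry.
have sWV : nbhs (u - s *: w) (W `&` V) by apply: filterI => //; exact: nW.
have [v [c [[Wv Vv] c0 sub]]] := subgradient_near fccp fs_y sWV.
set h := c *: _ in sub.
(* [h] is a nonnegative multiple of [u - s *: w - v], so the extra term is nonnegative and
   [s * dotv h w <= dotv h (u - v)]. *)
have hu : dotv h (u - v) = s * dotv h w +
    c * dotv (u - s *: w - v) (u - s *: w - v).
  rewrite -(dotvZl c) -/h -dotvZr -dotvDr; congr (dotv _ _).
  by apply/colP => i; rewrite !mxE; ring.
have huw : dotv h (u + w - v) = dotv h (u - v) + dotv h w.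
  by rewrite -dotvDr addrAC.
have := sub u; rewrite !fE -EFinD lee_fin => sub_u.
have := smooth v (u + w) h d sub d0 Ld.
rewrite !fE Ldl -EFinM -!EFinD lee_fin huw !enorm_sqr.
have := hgam s s0; rewrite !fE -EFinB lee_fin => hs.
have := Vphi _ Vv => phiv.
have P0 : 0 <= c * dotv (u - s *: w - v) (u - s *: w - v).
  by rewrite mulr_ge0 ?dotvv_ge0.
(* Chain [s * dotv h w <= dotv h (u - v) <= phi u - phi v <= s * gam + s * eta]. *)
have hw : dotv h w <= gam + eta by rewrite -(ler_pM2l s0) mulrDr; lra.
have : l * dotv (u + w - v) (u + w - v) <= l * (dotv w w + eta).
  by rewrite ler_wpM2l// sqr_distC ltW.
have : 0 <= l * eta by rewrite mulr_ge0// ltW.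
rewrite eE; lra.
Qed.

(** The inequality for [f] with subgradient [a^-1 *: g] and parameter [d / a], multiplied by [a], is
    the one wanted. *)
Lemma inexactly_smooth_scale n (f : 'cV[R]_n -> \bar R) (a : R) :
  inexactly_smooth L f -> 0 < a ->
  inexactly_smooth (fun d => a%:E * L (d / a)%R)%E (fun x => a%:E * f x)%E.
Proof.
move=> hf a0; have [[lf cf _] smooth] := hf.
pose phi x := fine (f x).
have fE x : f x = (phi x)%:E by rewrite fineK// inexactly_smooth_fin.
split; [split|].
- move=> x c; rewrite fE -EFinM lte_fin mulrC -ltr_pdivrMr// => cx.
  have [|V xV Vc] := lf x (c / a); first by rewrite fE lte_fin.
  exists V => // y /Vc; rewrite !fE -EFinM !lte_fin.
  by rewrite ltr_pdivrMr// mulrC.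
- move=> x y t _ _ t01; have := cf x y t I I t01.
  rewrite !fE -!EFinM -!EFinD !lee_fin -(ler_pM2l a0) => /le_trans; apply.
  by rewrite le_eqVlt; apply/orP; left; apply/eqP; ring.
- split=> [x|]; first by rewrite fE -EFinM ltNyr.
  by exists 0; rewrite fE -EFinM ltry.
move=> x y g d sub d0 aL.
have Ld : (L (d / a)%R < +oo)%E.
  by move: aL; rewrite !ltey; apply: contra => /eqP ->; rewrite gt0_muley.
have da0 : 0 <= d / a by rewrite divr_ge0// ltW.
have [l l0 Ldl] := smoothness_modulus_fin da0 Ld.
have {}sub : subdifferential f x (a^-1 *: g).
  move=> z; have := sub z.
  rewrite !fE -!EFinM -!EFinD !lee_fin dotvZl => sub_z.
  by rewrite -(ler_pM2l a0) mulrDr mulrA mulfV ?gt_eqF// mul1r.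
have := smooth x y _ _ sub da0 Ld.
rewrite !fE Ldl -!EFinM -!EFinD !lee_fin -(ler_pM2l a0) dotvZl => /le_trans; apply.
rewrite le_eqVlt; apply/orP; left; apply/eqP; field.
by rewrite gt_eqF.
Qed.

Lemma inexactly_smooth_comp_affine m n (f : 'cV[R]_m -> \bar R)
    (A : 'M[R]_(m, n)) (b : 'cV[R]_m) :
  inexactly_smooth L f ->
  inexactly_smooth (fun d => (opnorm A ^+ 2)%:E * L d)%E
                   (fun x => f (A *m x - b)).
Proof.
move=> hf; have [[lf cf _] smooth] := hf.
pose phi x := fine (f x).
have fE x : f x = (phi x)%:E by rewrite fineK// inexactly_smooth_fin.
split; [split|].
- move=> x c /lf[V AV Vc].
  by exists ((fun x => A *m x - b) @^-1` V);
    [exact: mulmx_continuous|move=> y /Vc].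
- move=> x y t _ _ t01.
  have -> : A *m (t *: x + (1 - t) *: y) - b =
      t *: (A *m x - b) + (1 - t) *: (A *m y - b).
    by rewrite mulmxDr -!scalemxAr; apply/colP => i; rewrite !mxE; ring.
  exact: cf.
- split=> [x|]; first by rewrite fE ltNyr.
  by exists 0; rewrite fE ltry.
move=> x y g d sub d0 AL.
(* This is the subgradient inequality at [x - s *: (y - x)], on the far side of [x] from [y] when
   [s] is positive. *)
have lower s : (f (A *m x - b)%R - (s * dotv g (y - x))%:E <=
    f (A *m x - b - s *: (A *m (y - x)))%R)%E.
  have := sub (x - s *: (y - x)).
  rewrite mulmxBr -scalemxAr (addrAC _ _ (- b)) (addrAC x) subrr add0r.
  by rewrite dotvNr dotvZr.
have [Ld|] := boolP (L d < +oo)%E.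
  have [l l0 Ldl] := smoothness_modulus_fin d0 Ld.
  have := inexactly_smooth_along hf (fun s _ => lower s) d0 Ld.
  rewrite (_ : A *m x - b + _ = A *m y - b); last first.
    by rewrite mulmxBr; apply/colP => i; rewrite !mxE; ring.
  rewrite !fE Ldl -!EFinM -!EFinD !lee_fin => /le_trans; apply.
  rewrite lerD2r lerD2l [leRHS]mulrC !mulrA [leRHS]mulrC mulrA.
  have h : enorm (A *m (y - x)) ^+ 2 <= opnorm A ^+ 2 * enorm (y - x) ^+ 2.
    rewrite -exprMn ler_sqr ?nnegrE ?enorm_ge0 ?enorm_mulmx_le//.
    by rewrite mulr_ge0 ?enorm_ge0 ?opnorm_ge0.
  have := ler_wpM2l (mulr_ge0 l0 (ltW (_ : 0 < 2^-1))) h.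
  lra.
rewrite -leNgt leye_eq => /eqP Ld.
(* With [L d = +oo], the product is finite only through [0 * +oo = 0]. Then [A *m y = A *m x], and
   [lower 1] yields [0 <= dotv g (y - x)]. *)
have A0 : opnorm A = 0.
  apply: contraTeq AL => A0.
  by rewrite Ld gt0_muley ?ltxx// lte_fin exprn_even_gt0.
have Aw : A *m (y - x) = 0.
  apply: enorm_eq0; apply/eqP; rewrite eq_le enorm_ge0 andbT.
  by have := enorm_mulmx_le A (y - x); rewrite A0 mul0r.
have := lower 1; rewrite Aw scaler0 subr0 A0 expr0n/= !mul0e adde0 mul1r.
have -> : A *m y = A *m x by apply/eqP; rewrite -subr_eq0 -mulmxBr Aw.
rewrite !fE -!EFinD !lee_fin; lra.
Qed.

Lemma inexactly_smooth_partial_inf n p (f : 'cV[R]_(n + p) -> \bar R) :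
  inexactly_smooth L f ->
  closed_fun (partial_inf f) -> proper_fun (partial_inf f) ->
  (forall x, exists z, f (col_mx x z) = partial_inf f x) ->
  inexactly_smooth L (partial_inf f).
Proof.
move=> [[_ cf _] smooth] clF prF attained.
have F_le x z : (partial_inf f x <= f (col_mx x z))%E.
  by apply: ereal_inf_lbound; exists z.
split; first split=> //.
  move=> x y t _ _ t01.
  (* The combination of the two minimizers is a competitor in the infimum at the combined point. *)
  have [z1 <-] := attained x; have [z2 <-] := attained y.
  apply: le_trans (F_le _ (t *: z1 + (1 - t) *: z2)) _.
  by rewrite -add_col_mx -!scale_col_mx; exact: cf.
move=> x y g d sub d0 Ld; have [z fz] := attained x.
have col0 u : col_mx u z - col_mx x z = col_mx (u - x) 0.
  by rewrite opp_col_mx add_col_mx subrr.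
have dotv0 : dotv (0 : 'cV[R]_p) 0 = 0.
  by apply: big1 => i _; rewrite mxE mul0r.
have sub_f : subdifferential f (col_mx x z) (col_mx g 0).
  move=> v; rewrite -(vsubmxK v) fz.
  apply: le_trans (le_trans (sub (usubmx v)) (F_le _ (dsubmx v))).
  rewrite opp_col_mx add_col_mx dotv_col_mx.
  by rewrite (_ : dotv 0 _ = 0) ?addr0//; apply: big1 => i _; rewrite mxE mul0r.
(* Keeping the same [z] makes the displacement [(y - x, 0)], and [f] at [(y, z)] bounds the infimum
   at [y] from above. *)
have := smooth _ (col_mx y z) _ d sub_f d0 Ld.
rewrite fz col0 dotv_col_mx !enorm_sqr dotv_col_mx dotv0 !addr0.
exact/le_trans/F_le.
Qed.

End inexact_smoothness.

Theorem lemma2p5 (R : realType) (L : R -> \bar R)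
    (hL : smoothness_modulus L) :
  [/\ (forall (n : nat) (f : 'cV[R]_n -> \bar R), inexactly_smooth L f ->
         forall a : R, 0 < a ->
         inexactly_smooth (fun d => a%:E * L (d / a)%R)%E
                          (fun x => a%:E * f x)%E),
      (forall (m : nat) (f : 'cV[R]_m -> \bar R), inexactly_smooth L f ->
         forall (n : nat) (A : 'M[R]_(m, n)) (b : 'cV[R]_m),
         inexactly_smooth (fun d => (opnorm A ^+ 2)%:E * L d)%E
                          (fun x => f (A *m x - b))) &
      (forall (n p : nat) (f : 'cV[R]_(n + p) -> \bar R),
         inexactly_smooth L f ->
         closed_fun (partial_inf f) -> proper_fun (partial_inf f) ->
         (forall x, exists z, f (col_mx x z) = partial_inf f x) ->
         inexactly_smooth L (partial_inf f))].
Proof.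
split.
- by move=> n f hf a; exact: inexactly_smooth_scale.
- by move=> m f hf n A b; exact: inexactly_smooth_comp_affine.
- by move=> n p f hf; exact: inexactly_smooth_partial_inf.
Qed.
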